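(* The set of degree sequences $$\mathbb D:=\bigcup\{\mathbb D(n,\Sigma,c_1,c_2)\;:\;\mathbb D(n,\Sigma,c_1,c_2)\text{ is fully graphic}\},$$ where the union ranges over all positive integers $n>c_1\ge c_2$ and all even positive integers $\Sigma$, is $P$-stable.
   Context: A degree sequence of length $n$ is a sequence $D=(d_1,\dots,d_n)$ of positive integers, each at most $n-1$, with even sum; write $|D|=n$. It is graphic if there is a simple graph on vertex set $\{1,\dots,n\}$ in which vertex $i$ has degree $d_i$ for every $i$; such a graph is called a realization of $D$. $\mathcal G(D)$ denotes the set of all (labelled) realizations of $D$; it is empty if $D$ (an arbitrary integer vector) has no realization. For positive integers $n>c_1\ge c_2$ and even $\Sigma$, $\mathbb D(n,\Sigma,c_1,c_2)$ is the set of all degree sequences $(d_1,\dots,d_n)$ of length $n$ with $c_1\ge d_i\ge c_2$ for all $i$ and $\sum_i d_i=\Sigma$. A set of degree sequences is fully graphic if every element of it is graphic. For $1\le i,j\le n$, $1^{+i}_{+j}$ denotes the integer vector $e_i+e_j$ of length $n$, where $e_i$ is the $i$th standard unit vector. For a graphic degree sequence $D$ of length $n$, $$\partial^{++}(D)=\sum_{1\le i<j\le n}\frac{|\mathcal G(D+1^{+i}_{+j})|}{|\mathcal G(D)|}.$$ An infinite set $\mathbb D$ of degree sequences is called $P$-stable if there is a polynomial $p$ such that $\partial^{++}(D)\le p(|D|)$ for every graphic $D\in\mathbb D$. *)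

(* Defs.v *)
From mathcomp Require Import all_boot all_order all_algebra.
From mathcomp Require Import boolp classical_sets cardinality.

Set Implicit Arguments.
Unset Strict Implicit.
Unset Printing Implicit Defensive.

Import GRing.Theory Num.Theory.

Local Open Scope classical_set_scope.
Local Open Scope ring_scope.

(* A simple graph on the vertex set 'I_n is given by its adjacency matrix, so
   that labelled graphs form a finite type and realizations can be counted. *)
Definition simple_graph (n : nat) (G : 'M[bool]_n) : bool :=
  [forall i, ~~ G i i] && [forall i, forall j, G i j == G j i].

Definition degree (n : nat) (G : 'M[bool]_n) (i : 'I_n) : nat :=
  #|[set j | G i j]%SET|.

(* The target degrees are arbitrary naturals: the vectors D + e_i + e_j below
   need not be degree sequences. *)
Definition realizations (n : nat) (d : 'I_n -> nat) : {set 'M[bool]_n} :=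
  [set G | simple_graph G && [forall i, degree G i == d i]]%SET.

Definition add_units (n : nat) (d : 'I_n -> nat) (i j : 'I_n) : 'I_n -> nat :=
  fun k => (d k + (k == i) + (k == j))%N.

Definition degree_sequence (D : seq nat) : bool :=
  all (fun d => 0 < d <= size D - 1)%N D && ~~ odd (sumn D).

Definition entry (D : seq nat) (i : 'I_(size D)) : nat := nth 0%N D i.

Definition graphic (D : seq nat) : Prop :=
  exists G : 'M[bool]_(size D), G \in realizations (@entry D).

Definition partial_pp (D : seq nat) : rat :=
  \sum_(i < size D) \sum_(j < size D | (i < j)%N)
    #|realizations (add_units (@entry D) i j)|%:R
      / #|realizations (@entry D)|%:R.

Definition DD (n Sigma c1 c2 : nat) : set (seq nat) :=
  [set D | [/\ degree_sequence D, size D = n,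
               all (fun d => c2 <= d <= c1)%N D & sumn D = Sigma]].

Definition fully_graphic (A : set (seq nat)) : Prop :=
  forall D, A D -> graphic D.

Definition P_stable (A : set (seq nat)) : Prop :=
  [/\ forall D, A D -> degree_sequence D,
      infinite_set A &
      exists p : {poly rat}, forall D, A D -> graphic D ->
        partial_pp D <= p.[(size D)%:R]].

(* Main.v *)
(** Let G realize D + e_x + e_y, where D lies in a fully graphic region. The
    point is that G can be turned into a realization of D by changing only the
    edges inside a vertex set U of bounded size: then G is determined by that
    realization, by U and by the graph induced on U, so that
    |G(D + e_x + e_y)| <= C n^K |G(D)|.

    By the Erdos-Gallai theorem, in the form stating that for all disjoint A, B the sum
    of d over A is at most |A|(n - 1 - |B|) plus the sum of d over B, a set U works
    unless G[U] has a pair (A, B) with A almost a clique completely joined to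
    U \ B, with B almost independent and without neighbours in U \ A, and with
    x or y in B; here at most one exceptional pair of vertices is allowed, and
    only if both x and y are in B. Starting from x (or from {x, y}, after
    flipping the exceptional pair) and alternately adding neighbours and
    non-neighbours, a bounded number of vertices forces more and more vertices
    into A (the sets N_i) and into B (the sets E_i). If no contradiction
    appears within a few steps, then N_4 and E_4 or E_5 violate, for the whole
    vertex set, the Erdos-Gallai inequality of a more extreme sequence of the
    region: either all of N_4 is raised to c1, or everything outside N_4 is
    lowered to c2. This contradicts full graphicality. *)
Require Import Defs.
From mathcomp Require Import all_boot all_order all_algebra.
From mathcomp Require Import boolp classical_sets cardinality.
(* Imported again so that the [{set T}] lemmas (subsetP, setP, and the like)
   take precedence over their namesakes in classical_sets. *)
From mathcomp Require Import fintype finset perm zify.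

Set Implicit Arguments.
Unset Strict Implicit.
Unset Printing Implicit Defensive.

(** * Degrees, the slack of an Erdos-Gallai inequality, and edge flips *)

Section Graphs.
Variable T : finType.
Implicit Types (e : rel T) (A B U X Y : {set T}) (d f : T -> nat).

Definition graph e := symmetric e /\ irreflexive e.

Definition degin e B v := \sum_(w in B) (e v w : nat).

Definition deg e v := \sum_w (e v w : nat).

Lemma sum_subset (F : T -> nat) A B : A \subset B ->
  \sum_(v in A) F v <= \sum_(v in B) F v.
Proof.
move=> /subsetP AB; rewrite [X in _ <= X](bigID (mem A)) /=.
apply: leq_trans (leq_addr _ _); apply/eq_leq/eq_bigl => w.
by case: (boolP (w \in A)) => [/AB ->|_]; rewrite ?andbF.
Qed.

Lemma deg_split e B v : deg e v = degin e B v + degin e (~: B) v.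
Proof.
rewrite /deg /degin (bigID (mem B)) /=; congr (_ + _).
by apply: eq_bigl => w; rewrite inE.
Qed.

Lemma degin_double e A B : symmetric e ->
  \sum_(a in A) degin e B a = \sum_(b in B) degin e A b.
Proof.
move=> es; rewrite /degin exchange_big /=.
by apply: eq_bigr => b _; apply: eq_bigr => a _; rewrite es.
Qed.

Lemma degin_le e B v : degin e B v <= #|B|.
Proof. by rewrite -sum1_card; apply: leq_sum => w _; case: (e v w). Qed.

Lemma deginS e A B v : A \subset B -> degin e A v <= degin e B v.
Proof. exact: sum_subset. Qed.

Lemma deg_anti e B v : (forall w, w \notin B -> ~~ e v w) -> deg e v = degin e B v.
Proof.
move=> h; rewrite (deg_split e B) [X in _ + X]big1 ?addn0 // => w.
by rewrite inE => /h/negbTE ->.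
Qed.

Lemma degin_full e B v : (forall w, w \in B -> e v w) -> degin e B v = #|B|.
Proof. by move=> h; rewrite -sum1_card; apply: eq_bigr => w /h ->. Qed.

Lemma degin_anti e B v : (forall w, w \in B -> ~~ e v w) -> degin e B v = 0.
Proof. by move=> h; apply: big1 => w /h/negbTE ->. Qed.

Lemma degin_anti_sub e A B v : A \subset B -> (forall w, w \in A -> ~~ e v w) ->
  degin e B v + #|A| <= #|B|.
Proof.
move=> AB h; rewrite -(cardsID A B) (setIidPr AB) addnC leq_add2l.
apply: leq_trans (degin_le e _ v); rewrite /degin (bigID (mem A)) /=.
rewrite big1 => [|w /andP[_ /h/negbTE ->]] //.
by apply/eq_leq/eq_bigl => w; rewrite !inE andbC.
Qed.

Definition codefect e B a := #|[set w | [&& w \notin B, w != a & ~~ e a w]]|.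

Lemma codefectE e B a : irreflexive e -> a \notin B ->
  deg e a + 1 + codefect e B a = #|~: B| + degin e B a.
Proof.
move=> ei aB; rewrite (deg_split e B).
suff -> : #|~: B| = degin e (~: B) a + 1 + codefect e B a by lia.
have -> : degin e (~: B) a = #|[set w in ~: B | e a w]|.
  by rewrite -sum1dep_card big_mkcondr /=; apply: eq_bigr => w _; case: (e a w).
rewrite (cardsD1 a) inE aB addnC -addnA addnCA addnC; congr (_ + _).
rewrite -(cardsID [set w | e a w] (~: B :\ a)); congr (_ + _).
  by apply: eq_card => w; rewrite !inE; case: eqP => //= ->; rewrite ei andbF.
by apply: eq_card => w; rewrite !inE; case: (w \in B); case: (w == a); case: (e a w).
Qed.

(** Double counting the edges between [A] and [B] gives the exact slack of the Erdos-Gallai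
    inequality: the edges missing at [A] towards the complement of [B], plus the edges from [B] that
    avoid [A]. *)
Lemma cut_identity e A B : graph e -> [disjoint A & B] ->
  \sum_(a in A) deg e a + #|A| + \sum_(a in A) codefect e B a
    + \sum_(b in B) degin e (~: A) b
  = #|A| * #|~: B| + \sum_(b in B) deg e b.
Proof.
move=> [es ei] dAB.
have -> : \sum_(b in B) deg e b
    = \sum_(b in B) degin e A b + \sum_(b in B) degin e (~: A) b.
  by rewrite -big_split; apply: eq_bigr => b _; rewrite (deg_split e A).
rewrite addnA; congr (_ + _).
have -> : #|A| = \sum_(a in A) 1 by rewrite sum1_card.
rewrite -degin_double // -!big_split big_distrl -big_split /=.
apply: eq_bigr => a aA; rewrite mul1n codefectE //.
by apply: contraTN aA => aB; move/disjointFl: dAB => ->.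
Qed.

Lemma cut_necessary e d A B : graph e -> deg e =1 d -> [disjoint A & B] ->
  \sum_(a in A) d a + #|A| <= #|A| * #|~: B| + \sum_(b in B) d b.
Proof.
move=> ge eqd dAB.
have sumd C : \sum_(a in C) d a = \sum_(a in C) deg e a.
  by apply: eq_bigr => v _; rewrite eqd.
by rewrite !sumd -(cut_identity ge dAB) -addnA leq_addr.
Qed.

(** Ordering the vertices by [enum_rank] splits the adjacent ordered pairs into two halves of the
    same size. *)
Lemma handshake e : graph e -> ~~ odd (\sum_v deg e v).
Proof.
move=> [es ei].
pose lt (v w : T) := enum_rank v < enum_rank w.
pose s := \sum_v \sum_w (e v w && lt v w : nat).
suff -> : \sum_v deg e v = s + s by rewrite addnn odd_double.
have sE : s = \sum_v \sum_w (e w v && lt w v : nat) by rewrite /s exchange_big.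
rewrite {2}sE /s -big_split; apply: eq_bigr => v _.
rewrite -big_split; apply: eq_bigr => w _ /=.
rewrite /lt [e w v]es; case: ltngtP => [||/ord_inj/enum_rank_inj ->];
  by rewrite ?ei ?andbT ?andbF ?addn0.
Qed.

(** The exclusive or adds or deletes the pair as the case may be and is an involution, so that
    deletions reduce to additions. *)
Definition flip e u v : rel T :=
  fun a b => e a b (+) ((a == u) && (b == v) || (a == v) && (b == u)).

Lemma flip_graph e u v : u != v -> graph e -> graph (flip e u v).
Proof.
move=> uv [es ei]; split=> [a b|a]; rewrite /flip.
  rewrite es; congr (_ (+) _).
  by rewrite orbC [(b == u) && _]andbC [(b == v) && _]andbC.
by rewrite ei [(a == v) && _]andbC orbb; case: eqP => //= ->; apply: negbTE.
Qed.

Lemma deg_add e u v w : irreflexive e -> symmetric e -> u != v -> ~~ e u v ->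
  deg (flip e u v) w = deg e w + (w == u) + (w == v).
Proof.
move=> ei es uv euv.
have sumpt (z : T) : \sum_t (t == z : nat) = 1.
  by rewrite (bigD1 z) //= eqxx big1 ?addn0 // => t /negbTE ->.
have [->|wu] := eqVneq w u.
  rewrite (negbTE uv) addn0 -[true : nat](sumpt v) -big_split; apply: eq_bigr => t _.
  rewrite /flip eqxx (negbTE uv) /= orbF.
  by have [->|] := eqVneq t v; rewrite ?(negbTE euv) ?addbF ?addn0.
have [->|wv] := eqVneq w v.
  rewrite addn0 -[true : nat](sumpt u) -big_split; apply: eq_bigr => t _.
  rewrite /flip eqxx eq_sym (negbTE uv) /=.
  by have [->|] := eqVneq t u; rewrite ?[e v u]es ?(negbTE euv) ?addbF ?addn0.
rewrite !addn0; apply: eq_bigr => t _.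
by rewrite /flip (negbTE wu) (negbTE wv) /= addbF.
Qed.

Lemma flipK e u v : flip (flip e u v) u v =2 e.
Proof. by move=> a b; rewrite /flip -addbA addbb addbF. Qed.

Lemma eq_deg e e' : e =2 e' -> deg e =1 deg e'.
Proof. by move=> h v; apply: eq_bigr => w _; rewrite h. Qed.

Lemma deg_del e u v w : irreflexive e -> symmetric e -> u != v -> e u v ->
  deg (flip e u v) w + (w == u) + (w == v) = deg e w.
Proof.
move=> ei es uv euv; rewrite -(eq_deg (flipK e u v)).
have [fs fi] := flip_graph uv (conj es ei).
by rewrite (deg_add w fi fs uv) //= /flip !eqxx euv.
Qed.

End Graphs.

Ltac flip_tac :=
  rewrite /flip ?eqxx;
  repeat match goal with
  | H : is_true (?a != ?b) |- context [?a == ?b] => rewrite (negbTE H)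
  | H : is_true (?a != ?b) |- context [?b == ?a] => rewrite [b == a]eq_sym (negbTE H)
  end;
  rewrite /= ?andbF ?andbT ?orbF ?addbF ?addbT ?negbK.

Ltac nlia :=
  repeat match goal with
  | H : is_true (leq _ _) |- _ => revert H
  | H : @eq nat _ _ |- _ => revert H
  end; clear; intros; lia.

(** * The Erdos-Gallai theorem by edge switching *)

Section ErdosGallai.
Variable T : finType.
Implicit Types (e : rel T) (A B P : {set T}) (d : T -> nat).

(** Otherwise the transposition of [i] and [r] would carry the neighbourhood of [i] into that of
    [r], even when the two are adjacent. *)
Lemma exists_private_neighbour e i r : graph e -> deg e r < deg e i ->
  exists u, [/\ e i u, ~~ e r u & u != r].
Proof.
move=> [es ei] lt.
case: (pickP [pred u | [&& e i u, ~~ e r u & u != r]]) => [u /and3P[]|none].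
  by exists u.
suff : deg e i <= deg e r by rewrite leqNgt lt.
rewrite [X in _ <= X](reindex_inj (@perm_inj _ (tperm i r))) /=.
apply: leq_sum => u _; case: tpermP => [->|->|_ ur]; rewrite ?ei ?[e r i]es //.
by have := none u; rewrite /= => /negbT; case: (e i u) (e r u) => [] [] //=; case: eqP ur.
Qed.

Lemma indep_flip e P r a b : a \in r |: P ->
  (forall u v, u \notin r |: P -> v \notin r |: P -> ~~ e u v) ->
  forall u v, u \notin r |: P -> v \notin r |: P -> ~~ flip e a b u v.
Proof.
move=> aP h u v uP vP; rewrite /flip.
have -> : (u == a) = false by apply: contraNF uP => /eqP ->.
have -> : (v == a) = false by apply: contraNF vP => /eqP ->.
by rewrite andbF addbF h.
Qed.

Definition subrealization d P r e :=
  [/\ graph e, forall v, deg e v <= d v, forall v, v \in P -> deg e v = d v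
    & forall u v, u \notin r |: P -> v \notin r |: P -> ~~ e u v].

Definition cut_condition d := forall A B, [disjoint A & B] ->
  \sum_(a in A) d a + #|A| <= #|A| * #|~: B| + \sum_(b in B) d b.

(* A step of the Tripathi-Venugopalan-West proof: the vertices of P already have
   their target degree, those outside [r |: P] are pairwise non-adjacent, and
   exchanging at most four edges raises the degree of r. *)
Lemma improve d P r e : ~~ odd (\sum_v d v) -> cut_condition d ->
  r \notin P -> (forall u, u \in P -> d r <= d u) ->
  subrealization d P r e -> deg e r < d r ->
  exists2 e', subrealization d P r e' & deg e r < deg e' r.
Proof.
move=> dev cut rP dP [ge led eqd ind] ltr.
have [es ei] := ge.
have nr u : u \in P -> u != r by apply: contraTneq => ->.
have rA : r \in r |: P by rewrite setU11.
have PA u : u \in P -> u \in r |: P by move=> uP; rewrite setU1r.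
have gtP i : i \in P -> deg e r < deg e i.
  by move=> iP; rewrite (eqd i iP); apply: leq_trans ltr (dP i iP).
have notP k : deg e k < d k -> k \notin P.
  by apply: contraTN => kP; rewrite eqd ?ltnn.
have nPP u v : u \notin P -> v \in P -> u != v.
  by move=> uP vP; apply: contraNneq uP => ->.
(* A non-neighbour of [r] below its target: add the edge. *)
have [k /and3P[kr erk ltk]|C0] :=
  pickP [pred k | [&& k != r, ~~ e r k & deg e k < d k]].
  have rk : r != k by rewrite eq_sym.
  have D v := deg_add v ei es rk erk.
  exists (flip e r k); last by rewrite D eqxx; nlia.
  split; [exact: flip_graph| | |exact: indep_flip].
    move=> v; rewrite D; have [->|_] := eqVneq v r; first by rewrite (negbTE rk); nlia.
    by have [->|_] := eqVneq v k; [nlia | rewrite !addn0].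
  move=> v vP; rewrite D (negbTE (nr v vP)).
  by rewrite eq_sym (negbTE (nPP _ _ (notP _ ltk) vP)) !addn0 eqd.
have {}C0 k : k != r -> deg e k < d k -> e r k.
  by move=> kr ltk; have := C0 k; rewrite /= kr ltk andbT => /negbFE.
(* A vertex [i] of [P] not adjacent to [r]: trading [iu] for [ru] and [ri] raises [r] by 2 and
   changes no other degree. *)
have [i /andP[iP eri]|C1] := pickP [pred i | (i \in P) && ~~ e r i].
  have [u [eiu eru ur]] := exists_private_neighbour ge (gtP i iP).
  have ir := nr i iP.
  have iu : i != u by apply: contraTneq eiu => <-; rewrite ei.
  have [g1s g1i] := flip_graph iu ge.
  have ri : r != i by rewrite eq_sym.
  have ru : r != u by rewrite eq_sym.
  have D1 v := deg_del v ei es iu eiu.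
  have e2 : ~~ flip e i u r u by flip_tac.
  have [g2s g2i] := flip_graph ru (conj g1s g1i).
  have D2 v := deg_add v g1i g1s ru e2.
  have e3 : ~~ flip (flip e i u) r u r i by flip_tac.
  have D3 v := deg_add v g2i g2s ri e3.
  set e1 := flip (flip (flip e i u) r u) r i in D3.
  have g3 : graph e1 by apply: flip_graph.
  have D v : deg e1 v = deg e v + (v == r) + (v == r).
    by rewrite D3 D2 -(D1 v); nlia.
  have I1 : forall v w, v \notin r |: P -> w \notin r |: P -> ~~ e1 v w.
    by do 3!(apply: indep_flip; first by rewrite ?rA ?PA).
  have [big|small] := leqP (deg e r + 2) (d r).
    exists e1; last by rewrite D eqxx; nlia.
    split=> // [v|v vP]; rewrite D; last by rewrite (negbTE (nr v vP)) !addn0 eqd.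
    by have [->|_] := eqVneq v r; [nlia | rewrite !addn0].
  (* If [r] lacks only one, parity of the degree sums yields another deficient vertex [k], which is
     adjacent to [r]; deleting [rk] takes back the excess. *)
  have [k kr ltk] : exists2 k, k != r & deg e k < d k.
    have [k /andP[kr ltk]|none] := pickP [pred k | (k != r) && (deg e k < d k)].
      by exists k.
    have := handshake ge.
    suff -> : \sum_v deg e v = (\sum_v d v).-1.
      by rewrite (bigD1 r) //=; move: dev; rewrite (bigD1 r) //=; move: small ltr; clear; lia.
    rewrite (bigD1 r) //= [in RHS](bigD1 r) //= (eq_bigr d) => [|v vr]; first by nlia.
    apply/eqP; rewrite eqn_leq led leqNgt /=.
    by have := none v; rewrite /= vr /= => ->.
  have erk := C0 _ kr ltk; have kP := notP _ ltk.
  have ki : k != i by apply: nPP.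
  have ku : k != u by apply: contraNneq eru => <-.
  have rk : r != k by rewrite eq_sym.
  have e4 : e1 r k by rewrite /e1; flip_tac.
  have [g3s g3i] := g3.
  have D4 v := deg_del v g3i g3s rk e4.
  exists (flip e1 r k).
    split; [exact: flip_graph| | |exact: indep_flip].
      move=> v; have := D4 v; rewrite D; have := led v.
      by have [->|_] := eqVneq v r; rewrite ?(negbTE rk); nlia.
    move=> v vP; have := D4 v; rewrite D (negbTE (nr v vP)).
    by rewrite eq_sym (negbTE (nPP _ _ kP vP)) !addn0 eqd.
  by have := D4 r; rewrite D eqxx (negbTE rk); nlia.
have {}C1 i : i \in P -> e r i by move=> iP; have := C1 i; rewrite /= iP => /negbFE.
(* Such a [k] is adjacent to [r] and has too few neighbours to be joined to all of [P] as well: for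
   a missed [i] in [P], trade [iu] for [ru] and [ik]. *)
have [k /and3P[kA ltd ltP]|C2] :=
    pickP [pred k | [&& k \notin r |: P, deg e k < d k & deg e k <= #|P|]].
  have /norP[kr kP] : ~~ ((k == r) || (k \in P)) by move: kA; rewrite !inE.
  have erk := C0 _ kr ltd.
  have [i iP eki] : exists2 i, i \in P & ~~ e k i.
    have [i /andP[iP eki]|none] := pickP [pred i | (i \in P) && ~~ e k i].
      by exists i.
    suff : #|r |: P| <= deg e k by rewrite cardsU1 rP; nlia.
    rewrite (deg_split e (r |: P)) [degin _ _ _]degin_full ?leq_addr // => w.
    rewrite !inE => /orP[/eqP ->|wP]; first by rewrite es.
    by have := none w; rewrite /= wP => /negbFE.
  have [u [eiu eru ur]] := exists_private_neighbour ge (gtP i iP).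
  have ir := nr i iP.
  have iu : i != u by apply: contraTneq eiu => <-; rewrite ei.
  have ki : k != i by apply: nPP.
  have ku : k != u by apply: contraNneq eki => ->; rewrite es.
  have ik : i != k by rewrite eq_sym.
  have ru : r != u by rewrite eq_sym.
  have eik : ~~ e i k by rewrite es.
  have D1 v := deg_del v ei es iu eiu.
  have [g1s g1i] := flip_graph iu ge.
  have e2 : ~~ flip e i u r u by flip_tac.
  have [g2s g2i] := flip_graph ru (conj g1s g1i).
  have D2 v := deg_add v g1i g1s ru e2.
  have e3 : ~~ flip (flip e i u) r u i k by flip_tac.
  have D3 v := deg_add v g2i g2s ik e3.
  set e1 := flip (flip (flip e i u) r u) i k in D3.
  have g3 : graph e1 by apply: flip_graph.
  have D v : deg e1 v = deg e v + (v == r) + (v == k).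
    by rewrite D3 D2 -(D1 v); nlia.
  have I1 : forall v w, v \notin r |: P -> w \notin r |: P -> ~~ e1 v w.
    by do 3!(apply: indep_flip; first by rewrite ?rA ?PA).
  have rk : r != k by rewrite eq_sym.
  exists e1; last by rewrite D eqxx; nlia.
  split=> // [v|v vP]; rewrite D.
    have := led v; have [->|_] := eqVneq v r; first by rewrite (negbTE rk); nlia.
    by have [->|_] := eqVneq v k; nlia.
  by rewrite (negbTE (nr v vP)) eq_sym (negbTE (nPP _ _ kP vP)) !addn0 eqd.
(* Two non-adjacent vertices of [P]: trade [iu] and [jw] for [ru] and [ij]. Only [w] loses a degree,
   and it lies outside [P] because [P] is by now joined to [r]. *)
have [[i j] /and4P[/= iP jP ij eij]|C3] :=
    pickP [pred p | [&& p.1 \in P, p.2 \in P, p.1 != p.2 & ~~ e p.1 p.2]].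
  have [u [eiu eru ur]] := exists_private_neighbour ge (gtP i iP).
  have [w [ejw erw wr]] := exists_private_neighbour ge (gtP j jP).
  have ir := nr i iP; have jr := nr j jP.
  have ru : r != u by rewrite eq_sym.
  have iu : i != u by apply: contraTneq eiu => <-; rewrite ei.
  have jw : j != w by apply: contraTneq ejw => <-; rewrite ei.
  have ju : j != u by apply: contraNneq eij => ->.
  have iw : i != w by apply: contraNneq eij => ->; rewrite es.
  have wP : w \notin P by apply: contraNN erw => /C1.
  have D1 v := deg_del v ei es iu eiu.
  have [g1s g1i] := flip_graph iu ge.
  have e2 : flip e i u j w by flip_tac.
  have D2 v := deg_del v g1i g1s jw e2.
  have [g2s g2i] := flip_graph jw (conj g1s g1i).
  have e3 : ~~ flip (flip e i u) j w r u by flip_tac.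
  have [g3s g3i] := flip_graph ru (conj g2s g2i).
  have D3 v := deg_add v g2i g2s ru e3.
  have e4 : ~~ flip (flip (flip e i u) j w) r u i j by flip_tac.
  have D4 v := deg_add v g3i g3s ij e4.
  set e1 := flip _ i j in D4.
  have g4 : graph e1 by apply: flip_graph.
  have D v : deg e1 v + (v == w) = deg e v + (v == r).
    by rewrite D4 D3 -(D1 v) -(D2 v); nlia.
  have I1 : forall a b, a \notin r |: P -> b \notin r |: P -> ~~ e1 a b.
    by do 4!(apply: indep_flip; first by rewrite ?rA ?PA).
  exists e1; last by have := D r; rewrite eqxx eq_sym (negbTE wr); nlia.
  split=> // [v|v vP]; have := D v.
    have := led v; have [->|_] := eqVneq v r; nlia.
  by rewrite (negbTE (nr v vP)) eq_sym (negbTE (nPP _ _ wP vP)) !addn0 eqd.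
(* No switch applies. Then [A] is a clique, the vertices outside [A] and [B] are joined to all of
   [A], and [B] is saturated with all its neighbours in [A]. So the slack is zero while [r] is
   deficient, against the cut condition. *)
pose A := r |: P; pose B := [set k | (k \notin A) && (deg e k <= #|P|)].
have dAB : [disjoint A & B].
  by rewrite disjoint_subset; apply/subsetP => a aA; rewrite inE /= inE aA.
have eqB b : b \in B -> deg e b = d b.
  rewrite inE => /andP[bA leb]; apply/eqP; rewrite eqn_leq led leqNgt /=.
  by have := C2 b; rewrite /= bA leb andbT /= => ->.
have clique a w : a \in A -> w \in A -> w != a -> e a w.
  rewrite !inE => /predU1P[->|aP] /predU1P[->|wP]; rewrite ?eqxx // => wa.
  - exact: C1.
  - by rewrite es; apply: C1.
  - by have := C3 (a, w); rewrite /= aP wP eq_sym wa => /negbFE.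
have := cut A B dAB; have := cut_identity ge dAB.
rewrite [X in _ + X + _]big1 ?addn0 => [|a aA]; last first.
  apply/eqP; rewrite cards_eq0; apply/eqP/setP => w; rewrite in_set in_set0.
  apply/negbTE/and3P => -[wB wa /negP eaw]; apply: eaw.
  have [wA|wA] := boolP (w \in A); first exact: clique.
  move: wB; rewrite in_set wA /= -ltnNge => ltw.
  have wE : deg e w = degin e A w.
    by apply: deg_anti => z zA; apply: ind.
  have full : degin e A w = #|A|.
    by apply/eqP; rewrite eqn_leq degin_le -wE cardsU1 rP.
  rewrite es; apply: contraTT (leqnn #|A|) => ewa.
  rewrite -{2}full -ltnNge (cardsD1 a) aA /degin (bigD1 a) //= (negbTE ewa) add0n ltnS.
  apply: leq_trans (degin_le e (A :\ a) w); apply/eq_leq/eq_bigl => z.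
  by rewrite !inE andbC.
rewrite [X in _ + X = _]big1 ?addn0 => [|b]; last first.
  rewrite inE => /andP[bA _]; apply: degin_anti => w; rewrite inE => wA.
  exact: ind.
rewrite (eq_bigr d eqB) => <-.
have : \sum_(a in A) deg e a < \sum_(a in A) d a; last by nlia.
rewrite (bigD1 r) //= [in X in _ < X](bigD1 r) //= -addSn leq_add //.
by apply: leq_sum.
Qed.

Lemma saturate d P r e : ~~ odd (\sum_v d v) -> cut_condition d ->
  r \notin P -> (forall u, u \in P -> d r <= d u) ->
  subrealization d P r e ->
  exists2 e', subrealization d P r e' & deg e' r = d r.
Proof.
move=> dev cut rP dP; have [m] := ubnP (d r - deg e r).
elim: m e => // m IHm e ltm se; have [_ led _ _] := se.
have [lt|ge] := ltnP (deg e r) (d r); last first.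
  by exists e => //; apply/eqP; rewrite eqn_leq led.
have [e' se' lt'] := improve dev cut rP dP se lt.
by apply: (IHm e') => //; lia.
Qed.

(** Vertices are saturated in order of decreasing target, starting from the empty graph; [improve]
    needs this order for its private neighbours. *)
Theorem erdos_gallai d : ~~ odd (\sum_v d v) -> cut_condition d ->
  exists2 e, graph e & deg e =1 d.
Proof.
move=> dev cut.
have: forall m, m <= #|T| -> exists P e,
    [/\ #|P| = m, forall u v, u \in P -> v \notin P -> d v <= d u
      & [/\ graph e, forall v, deg e v <= d v,
            forall v, v \in P -> deg e v = d v
          & forall u v, u \notin P -> v \notin P -> ~~ e u v]].
  elim=> [_|m IHm ltm].
    exists set0, (fun _ _ => false); rewrite cards0.
    split=> // [u v|]; first by rewrite inE.
    by split=> // [v|v]; rewrite ?inE // /deg big1.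
  have [P [e [cP dP [ge led eqd ind]]]] := IHm (ltnW ltm).
  have [r0 r0P] : exists r0, r0 \notin P.
    apply/existsP; apply: contraLR ltm; rewrite negb_exists => /forallP allP.
    rewrite -leqNgt -cP -cardsT; apply: subset_leq_card.
    by apply/subsetP => w _; move: (allP w); rewrite negbK.
  have [r rP rmax] := @arg_maxnP _ r0 [pred v | v \notin P] d r0P.
  rewrite /= in rP.
  have [| |e' [ge' led' eqd' ind'] er] := saturate dev cut rP (r := r) (e := e).
  - by move=> u uP; apply: dP.
  - split=> // u v; rewrite !inE !negb_or => /andP[_ uP] /andP[_ vP].
    exact: ind.
  exists (r |: P), e'; split; first by rewrite cardsU1 rP cP.
    move=> u v; rewrite !inE negb_or => /predU1P[->|uP] /andP[_ vP].
      exact: rmax.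
    exact: dP.
  by split=> // v; rewrite !inE => /predU1P[->|/eqd'].
move=> /(_ _ (leqnn _)) [P [e [cP _ [ge _ eqd _]]]].
exists e => // v; apply: eqd.
have /eqP -> : P == setT by rewrite eqEcard subsetT cardsT cP leqnn.
by rewrite inE.
Qed.

End ErdosGallai.

(** * Levels forced by a starting set *)

Section Region.
Variable T : finType.
Implicit Types (e : rel T) (A B X Y : {set T}).

(** Supplies a sequence of the region that has the prescribed sum and is extreme on a chosen set;
    one entry is raised by one at a time. *)
Lemma interpolate (lo hi : T -> nat) s : (forall v, lo v <= hi v) ->
  \sum_v lo v <= s <= \sum_v hi v ->
  exists2 f, forall v, lo v <= f v <= hi v & \sum_v f v = s.
Proof.
move=> + /andP[]; have [m] := ubnP (s - \sum_v lo v).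
elim: m lo => // m IHm lo ltm lohi los shi.
have [eqs|/eqP ne] := eqVneq (\sum_v lo v) s.
  by exists lo => // v; rewrite leqnn lohi.
have [u ltu|none] := pickP [pred u | lo u < hi u]; last first.
  suff : \sum_v hi v <= \sum_v lo v by lia.
  by apply: leq_sum => v _; rewrite leqNgt; have := none v => /= ->.
pose lo' v := lo v + (v == u).
have slo' : \sum_v lo' v = (\sum_v lo v).+1.
  rewrite big_split /= -addn1; congr (_ + _).
  by rewrite (bigD1 u) //= eqxx big1 // => v /negbTE ->.
have [||||f lof <-] := IHm lo'; rewrite ?slo' //; try by [clear -ltm los ne; lia].
  move=> v; rewrite /lo'; have [->|_] := eqVneq v u; first by rewrite addn1.
  by rewrite addn0.
by exists f => // v; have /andP[h ->] := lof v; rewrite (leq_trans _ h) ?leq_addr.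
Qed.

Definition nb e Y := [set v | [exists u, (u \in Y) && e u v]].

Definition conb e Y := [set v | [exists u, [&& u \in Y, u != v & ~~ e u v]]].

(** If [A] is a clique joined to everything outside [B], and [B] has neighbours only in [A], then
    neighbours of [B] lie in [A] and non-neighbours of [A] lie in [B]. The levels iterate these two
    rules from [X] in [B]. *)
Fixpoint lev e X i :=
  if i is j.+1 then X :|: conb e (nb e (lev e X j)) else X.

Lemma mem_nb e Y u v : u \in Y -> e u v -> v \in nb e Y.
Proof. by move=> uY uv; rewrite inE; apply/existsP; exists u; rewrite uY. Qed.

Lemma mem_conb e Y u v : u \in Y -> u != v -> ~~ e u v -> v \in conb e Y.
Proof. by move=> uY uv nuv; rewrite inE; apply/existsP; exists u; rewrite uY uv. Qed.

Lemma nbS e A B : A \subset B -> nb e A \subset nb e B.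
Proof.
move=> /subsetP AB; apply/subsetP => v; rewrite inE => /existsP[u /andP[/AB uB]].
exact: mem_nb.
Qed.

Lemma conbS e A B : A \subset B -> conb e A \subset conb e B.
Proof.
move=> /subsetP AB; apply/subsetP => v; rewrite inE => /existsP[u /and3P[/AB uB]].
exact: mem_conb.
Qed.

Lemma lev_sub e X i : X \subset lev e X i.
Proof. by case: i => [|i] //=; apply: subsetUl. Qed.

Lemma levS e X i : lev e X i \subset lev e X i.+1.
Proof.
elim: i => [|i IHi]; first exact: subsetUl.
by rewrite [lev e X i.+1]/= [lev e X i.+2]/= setUS // conbS // nbS.
Qed.

Lemma lev_mono e X i j : i <= j -> lev e X i \subset lev e X j.
Proof.
move=> /subnK <-; elim: (j - i) => // k IHk.
exact: subset_trans IHk (levS _ _ _).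
Qed.

Lemma nb_lev_complete e X i u v :
  u \in nb e (lev e X i) -> v \notin lev e X i.+1 -> v != u -> e u v.
Proof.
move=> uN vE vu; apply: contraNT vE => nuv; rewrite [lev _ _ _]/= inE.
by rewrite (mem_conb uN _ nuv) ?orbT // eq_sym.
Qed.

Lemma lev_anti e X i u v :
  u \in lev e X i -> v \notin nb e (lev e X i) -> ~~ e u v.
Proof. by move=> uE; apply: contraNN => /(mem_nb uE). Qed.

Lemma codefect_nb_lev e X i j v : i <= j -> v \in nb e (lev e X i) ->
  codefect e (lev e X j.+1) v = 0.
Proof.
move=> ij vN; apply/eqP; rewrite cards_eq0; apply/eqP/setP => w; rewrite in_set in_set0.
apply/negbTE/and3P => -[wE wv]; apply/negP; rewrite negbK.
apply: nb_lev_complete vN _ wv; apply: contraNN wE; apply: (subsetP (lev_mono _ _ _)); lia.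
Qed.

Lemma sum_indicator A X : X \subset A -> \sum_(v in A) (v \in X : nat) = #|X|.
Proof.
move=> /subsetP XA; rewrite -sum1_card [RHS]big_mkcond [LHS]big_mkcond /=.
by apply: eq_bigr => v _; case: (boolP (v \in X)) => [/XA -> //|_]; case: ifP.
Qed.

(** * The contradiction with full graphicality *)

Section Barrier.
Variables (c1 c2 : nat) (D : T -> nat) (g0 e : rel T) (x y : T) (X : {set T}).
Variables (pp pm : T -> nat).

(* The intended e is g0 with at most one pair flipped, pp and pm recording the
   degrees changed by the flip. Indices start at [E 1 = X], as in the header. *)
Let E i := lev e X i.-1.
Let N i := nb e (lev e X i.-1).

Hypothesis c2_gt0 : 0 < c2.
Hypothesis Dbounds : forall v, c2 <= D v <= c1.
Hypothesis all_graphic : forall f : T -> nat, (forall v, c2 <= f v <= c1) ->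
  \sum_v f v = \sum_v D v -> exists2 g, graph g & deg g =1 f.
Hypothesis xy : x != y.
Hypothesis deg_g0 : forall v, deg g0 v = D v + (v == x) + (v == y).
Hypothesis ge : graph e.
Hypothesis deg_e : forall v, deg g0 v + pm v = deg e v + pp v.
Hypothesis Xxy : X \subset [set x; y].
(** Each vertex of [X] exceeds its target [D] by at least one in [g0]; the flip disturbs the forced
    region by less than this total surplus. *)
Hypothesis small : \sum_(v in N 4 :|: E 5) (pp v + pm v) < #|X|.
Hypothesis xN : x \notin N 4.
Hypothesis yN : y \notin N 4.
Hypothesis dNE : [disjoint N 4 & E 5].

Let cardX : #|X| <= 2.
Proof. by apply: leq_trans (subset_leq_card Xxy) _; rewrite cards2 xy. Qed.

Let small1 v : v \in N 4 :|: E 5 -> pp v + pm v <= 1.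
Proof.
move=> vR; rewrite -ltnS; apply: leq_trans cardX; apply: leq_ltn_trans small.
by rewrite (bigD1 v) //= leq_addr.
Qed.

Let N4R v : v \in N 4 -> v \in N 4 :|: E 5.
Proof. by move=> vN; rewrite inE vN. Qed.

Let E5R v : v \in E 5 -> v \in N 4 :|: E 5.
Proof. by move=> vN; rewrite inE vN orbT. Qed.

Let DX v : D v + (v \in X) <= deg e v + pp v.
Proof.
have := deg_e v; rewrite deg_g0.
have : (v \in X) <= (v == x) + (v == y).
  case: (boolP (v \in X)) => // /(subsetP Xxy); rewrite !inE.
  by case: (v == x) (v == y) => [] [].
nlia.
Qed.

Let DN v : v \in N 4 -> deg e v <= D v + pm v.
Proof.
move=> vN; have := deg_e v; rewrite deg_g0.
have -> : (v == x) = false by apply: contraNF xN => /eqP <-.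
have -> : (v == y) = false by apply: contraNF yN => /eqP <-.
nlia.
Qed.

Let Nmono i j : i <= j -> N i \subset N j.
Proof. by move=> ij; apply: nbS; apply: lev_mono; nlia. Qed.

Let X_witness : exists2 z, z \in X & deg e z <= #|N 1|.
Proof.
have /card_gt0P[z zX] : 0 < #|X| by apply: leq_ltn_trans small.
exists z => //; rewrite (@deg_anti _ e (N 1)) ?degin_le // => w.
exact: (@lev_anti e X 0).
Qed.

Let degN v j : 2 <= j <= 5 -> v \in N j.-1 ->
  deg e v + 1 = #|~: E j| + degin e (E j) v.
Proof.
case: j => [|[|j]] // /andP[_ j5] vN.
rewrite -codefectE; first by rewrite (@codefect_nb_lev e X j j) ?addn0.
  by case: ge.
have vN4 : v \in N 4 by apply: (subsetP (Nmono _) _ vN).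
move/disjointFr: dNE => /(_ _ vN4)/negbT; apply: contraNN; apply: (subsetP (lev_mono _ _ _)); nlia.
Qed.

(** A vertex of [N 1] is joined to everything else outside [E 2], and its degree exceeds its [D] by
    at most one. It exists because some vertex of [X] has positive degree. *)
Let c1_bound : #|~: E 2| <= c1 + 2.
Proof.
have [z zX dz] := X_witness.
have zE : z \in E 5 by apply: (subsetP (lev_sub _ _ _) _ zX).
have /card_gt0P[w wN] : 0 < #|N 1|.
  by have := DX z; have := small1 (E5R zE); have := Dbounds z; rewrite zX; nlia.
have wN4 : w \in N 4 by apply: (subsetP (Nmono _) _ wN).
have := @degN w 2 isT wN; have := DN wN4; have := small1 (N4R wN4).
have := Dbounds w; nlia.
Qed.

(** If [v] is not in [N 3], then [E 3] is strictly larger than [E 2] and [v] has no neighbour in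
    [E 3]; the strict growth improves the 2 of [c1_bound] to 1. *)
Let c1_local v : v \in N 4 -> #|~: E 4| + degin e (E 4) v <= c1 + 1 + pm v.
Proof.
move=> vN; have [vN3|vN3] := boolP (v \in N 3).
  by rewrite -(@degN v 4) //; have := DN vN; have := Dbounds v; nlia.
have E34 : E 3 \subset E 4 by apply: lev_mono.
have ltE : #|E 2| < #|E 3|.
  apply: proper_card; rewrite properE lev_mono //=; apply: contraNN vN3 => E32.
  have eqE : E 3 = E 2 by apply/eqP; rewrite eqEsubset E32 lev_mono.
  have eqE4 : E 4 = E 3 := congr1 (fun Y => X :|: conb e (nb e Y)) eqE.
  by move: vN; rewrite /N -/(E 4) eqE4.
have : degin e (E 4) v + #|E 3| <= #|E 4|.
  apply: degin_anti_sub E34 _ => w wE.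
  by case: ge => es _; rewrite es (lev_anti wE vN3).
have := c1_bound; have := cardsC (E 2); have := cardsC (E 4); nlia.
Qed.

(** A vertex of [E 4] has all its neighbours in [N 4]. The other vertices of [E 5] are joined to all
    of [N 1], which contains the at least [c2] neighbours of some vertex of [X]. *)
Let c2_local v : v \in E 5 -> c2 + (v \in X) <= degin e (N 4) v + pp v.
Proof.
move=> vE; have [vE4|vE4] := boolP (v \in E 4).
  have -> : degin e (N 4) v = deg e v.
    by rewrite -(@deg_anti _ e (N 4)) // => w; apply: lev_anti.
  by have := DX v; have := Dbounds v; nlia.
have -> : (v \in X) = false.
  by apply: contraNF vE4; apply: (subsetP (lev_sub _ _ _)).
have [z zX dz] := X_witness.
have zE : z \in E 5 by apply: (subsetP (lev_sub _ _ _) _ zX).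
have : #|N 1| <= degin e (N 4) v.
  apply: leq_trans (deginS e v (Nmono (isT : 1 <= 4))).
  rewrite degin_full // => w wN.
  have wN4 : w \in N 4 by apply: (subsetP (Nmono _) _ wN).
  case: ge => es _; rewrite es; apply: (@nb_lev_complete e X 2).
  - by apply: (subsetP (@Nmono 1 3 _) _ wN).
  - by [].
  - by apply: contraTneq vE => ->; move/disjointFr: dNE => /(_ _ wN4) ->.
by have := DX z; have := Dbounds z; have := small1 (E5R zE); rewrite zX; nlia.
Qed.

Lemma barrier_absurd : False.
Proof.
have [es ei] := ge.
have E45 : E 4 \subset E 5 by apply: lev_mono.
have dNE4 : [disjoint N 4 & E 4] by apply: disjointWr dNE.
have sN A (F : T -> nat) : \sum_(v in A) (F v + 1) = \sum_(v in A) F v + #|A|.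
  by rewrite big_split sum1_card.
have total : \sum_(v in E 5) pp v + \sum_(v in N 4) pm v < #|X|.
  apply: leq_ltn_trans small; rewrite big_split leq_add //; apply: sum_subset.
    exact: subsetUr.
  exact: subsetUl.
(* The sum of [D] decides which extreme sequence is available: either [N 4] is raised to [c1] with
   nothing else raised, or everything outside [N 4] is lowered to [c2] with nothing in [N 4]
   lowered. *)
have [le|gt] := leqP (#|N 4| * c1 + #|~: N 4| * c2) (\sum_v D v).
  pose lo v := if v \in N 4 then c1 else c2.
  pose hi v := if v \in N 4 then c1 else D v.
  have [||f lof sf] := @interpolate lo hi (\sum_v D v).
  - by move=> v; rewrite /lo /hi; case: ifP => // _; case/andP: (Dbounds v).
  - apply/andP; split; last first.
      by apply: leq_sum => v _; rewrite /hi; case: ifP => // _; case/andP: (Dbounds v).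
    rewrite (bigID (mem (N 4))) /=; apply: leq_trans le.
    rewrite -!sum_nat_const; apply/eq_leq; congr (_ + _).
      by apply: eq_bigr => v vN; rewrite /lo vN.
    by apply: eq_big => [v|v /negbTE vN]; rewrite ?in_setC // /lo vN.
  have [v||g gg dg] := all_graphic (f := f) => //.
    by have := lof v; have := Dbounds v; rewrite /lo /hi; case: ifP; nlia.
  have := cut_necessary gg dg dNE4.
  have -> : \sum_(v in N 4) f v = #|N 4| * c1.
    rewrite -sum_nat_const; apply: eq_bigr => v vN.
    by have := lof v; rewrite /lo /hi vN; nlia.
  (* All edges at [E 4] go to [N 4], so the degrees there can be counted from [N 4]; as [f] is at
     most [D] on [E 4], the surplus of [X] survives. *)
  have : \sum_(v in E 4) f v + #|X| <= \sum_(v in E 4) (deg e v + pp v).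
    rewrite -(sum_indicator (A := E 4) (lev_sub _ _ _)) -big_split.
    apply: leq_sum => v vE; apply: leq_trans (DX v); rewrite leq_add2r.
    have := lof v; rewrite /hi (disjointFl dNE4 vE); by case/andP.
  rewrite big_split /= [X in _ <= X + _](eq_bigr (degin e (N 4))) => [|v vE]; last first.
    by apply: deg_anti => w; apply: lev_anti.
  rewrite degin_double //.
  have : \sum_(v in N 4) (#|~: E 4| + degin e (E 4) v)
         <= \sum_(v in N 4) (c1 + 1 + pm v) by apply: leq_sum => v /c1_local.
  rewrite !big_split /= !sum_nat_const muln1.
  have : \sum_(v in E 4) pp v <= \sum_(v in E 5) pp v by apply: sum_subset.
  nlia.
pose lo v := if v \in N 4 then D v else c2.
pose hi v := if v \in N 4 then c1 else c2.
have [||f lof sf] := @interpolate lo hi (\sum_v D v).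
- by move=> v; rewrite /lo /hi; case: ifP => // _; case/andP: (Dbounds v).
- apply/andP; split.
    by apply: leq_sum => v _; rewrite /lo; case: ifP => // _; case/andP: (Dbounds v).
  rewrite [X in _ <= X](bigID (mem (N 4))) /=; apply: leq_trans (ltnW gt) _.
  rewrite -!sum_nat_const; apply/eq_leq; congr (_ + _).
    by apply: eq_bigr => v vN; rewrite /hi vN.
  by apply: eq_big => v; rewrite in_setC // /hi => /negbTE ->.
have [v||g gg dg] := all_graphic (f := f) => //.
  by have := lof v; have := Dbounds v; rewrite /lo /hi; case: ifP; nlia.
(* Here [E 5] replaces [E 4], since every vertex of [N 4] is joined to everything else outside
   [E 5], which fixes its degree. *)
have := cut_necessary gg dg dNE.
have -> : \sum_(v in E 5) f v = #|E 5| * c2.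
  rewrite -sum_nat_const; apply: eq_bigr => v vE.
  by have := lof v; rewrite /lo /hi (disjointFl dNE vE); nlia.
have : \sum_(v in E 5) (c2 + (v \in X)) <= \sum_(v in E 5) (degin e (N 4) v + pp v).
  by apply: leq_sum => v /c2_local.
rewrite !big_split /= sum_nat_const degin_double // sum_indicator ?lev_sub //.
have : \sum_(v in N 4) (#|~: E 5| + degin e (E 5) v)
       <= \sum_(v in N 4) (f v + 1 + pm v).
  apply: leq_sum => v vN; rewrite -degN //.
  by have := DN vN; have := lof v; rewrite /lo vN; nlia.
rewrite !big_split /= !sum_nat_const muln1.
nlia.
Qed.

End Barrier.
End Region.

(** * Defects of a pair of sets, and bounded certificates *)

Section Defects.
Variable T : finType.
Implicit Types (e : rel T) (A B U S X Y : {set T}).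

(** These ordered pairs are what the slack in [cut_identity] counts. *)
Definition defect e A B a w :=
  [&& a \in A, w \notin B, w != a & ~~ e a w] || [&& a \in B, w \notin A & e a w].

Definition tight e S A B := forall a w, a \in S -> w \in S -> ~~ defect e A B a w.

Lemma tightS e S S' A B : S \subset S' -> tight e S' A B -> tight e S A B.
Proof. by move=> /subsetP SS' h a w /SS' aS /SS' wS; apply: h. Qed.

Lemma card_defects e A B : [disjoint A & B] ->
  #|[set p | defect e A B p.1 p.2]|
  = \sum_(a in A) codefect e B a + \sum_(b in B) degin e (~: A) b.
Proof.
move=> dAB; rewrite -sum1dep_card big_mkcond /=.
rewrite -(pair_bigA _ (fun a w => if defect e A B a w then 1 else 0)) /=.
rewrite [in RHS]big_mkcond [X in _ = _ + X]big_mkcond -big_split.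
apply: eq_bigr => a _ /=; rewrite /defect.
have [aA|aA] := boolP (a \in A).
  rewrite (disjointFr dAB aA) addn0 /codefect -sum1dep_card [RHS]big_mkcond.
  by apply: eq_bigr => w _; rewrite orbF.
have [aB|aB] := boolP (a \in B); last by rewrite big1.
rewrite add0n /degin [RHS]big_mkcond; apply: eq_bigr => w _ /=.
by rewrite inE; case: (w \in A) (e a w) => [] [].
Qed.

(** Tracing [v] back to [X] adds at most three vertices per level: one in [B], its neighbour forced
    into [A], and a non-neighbour of the latter forced into [B]. Tightness on the traced vertices
    suffices. *)
Lemma forced e X i v : v \in lev e X i -> exists2 S : {set T}, #|S| <= 3 * i &
  forall A B, [disjoint A & B] -> X \subset B -> tight e S A B -> v \in B.
Proof.
elim: i v => [|i IHi] v.
  by exists set0; rewrite ?cards0 // => A B _ /subsetP XB _; apply: XB.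
rewrite [lev _ _ _]/= in_setU => /orP[vX|].
  by exists set0; rewrite ?cards0 // => A B _ /subsetP XB _; apply: XB.
rewrite inE => /existsP[u /and3P[+ uv nuv]].
rewrite inE => /existsP[w /andP[/IHi[S cS fS] wu]].
exists (S :|: [set w; u; v]).
  apply: leq_trans (leq_card_setU _ _) _; rewrite mulnS addnC leq_add //.
  apply: leq_trans (leq_card_setU _ _) _; rewrite cards2 cards1.
  by case: eqP.
move=> A B dAB XB tS.
have wB : w \in B by apply: fS dAB XB _; apply: tightS tS; apply: subsetUl.
have uA : u \in A.
  have := tS w u; rewrite !inE !eqxx !orbT => /(_ isT isT).
  by rewrite /defect wB wu andbT; case: (u \in A); rewrite ?orbT.
have := tS u v; rewrite !inE !eqxx !orbT => /(_ isT isT).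
by rewrite /defect uA nuv [v == u]eq_sym uv andbT; case: (v \in B).
Qed.

Lemma forced_nb e X i v : v \in nb e (lev e X i) -> exists2 S : {set T}, #|S| <= 3 * i + 2 &
  forall A B, [disjoint A & B] -> X \subset B -> tight e S A B -> v \in A.
Proof.
rewrite inE => /existsP[w /andP[/forced[S cS fS] wv]].
exists (S :|: [set w; v]).
  apply: leq_trans (leq_card_setU _ _) _; rewrite leq_add //.
  by rewrite cards2; case: eqP.
move=> A B dAB XB tS.
have wB : w \in B by apply: fS dAB XB _; apply: tightS tS; apply: subsetUl.
have := tS w v; rewrite !inE !eqxx !orbT => /(_ isT isT).
by rewrite /defect wB wv andbT; case: (v \in A); rewrite ?orbT.
Qed.

Lemma card_bigcup (I : finType) (P : {set I}) (F : I -> {set T}) m :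
  (forall i, #|F i| <= m) -> #|\bigcup_(i in P) F i| <= #|P| * m.
Proof.
move=> h; rewrite -sum_nat_const.
elim/big_rec2: _ => [|i S k _ le]; first by rewrite cards0.
by apply: leq_trans (leq_card_setU _ _) _; rewrite leq_add.
Qed.

Lemma sum_eq_indicator A u : \sum_(v in A) (v == u : nat) = (u \in A).
Proof.
have [uA|uA] := boolP (u \in A).
  by rewrite (bigD1 u) //= eqxx big1 ?addn0 // => v /andP[_ /negbTE ->].
by rewrite big1 // => v vA; case: eqP => // vu; rewrite -vu vA in uA.
Qed.

End Defects.

Local Arguments lev : simpl never.

(** * Blocking sets and local repair *)

Section Repair.
Variable T : finType.
Implicit Types (e : rel T) (A B U S X Y : {set T}).

Variables (c1 c2 : nat) (D : T -> nat).
Hypothesis c2_gt0 : 0 < c2.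
Hypothesis Dbounds : forall v, c2 <= D v <= c1.
Hypothesis all_graphic : forall f : T -> nat, (forall v, c2 <= f v <= c1) ->
  \sum_v f v = \sum_v D v -> exists2 g, graph g & deg g =1 f.

(** The starting set is [x] alone, without a flip; [lev g X 3] and [lev g X 4] are [E 4] and [E 5]
    of the barrier. Either [y] is forced into [A], or some vertex into both [A] and [B], or the
    barrier applies. *)
Lemma single_blocker (g : rel T) x y : x != y -> graph g ->
  (forall v, deg g v = D v + (v == x) + (v == y)) ->
  exists2 S : {set T}, #|S| <= 24 &
  forall A B, [disjoint A & B] -> x \in B -> y \notin A -> ~ tight g S A B.
Proof.
move=> xy gg dg; pose X := [set x].
have [yN|yN] := boolP (y \in nb g (lev g X 3)).
  have [S cS fS] := forced_nb yN; exists S; first by apply: leq_trans cS _.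
  move=> A B dAB xB yA tS; move/negP: yA; apply; apply: fS dAB _ tS.
  by rewrite sub1set.
have [dNE|] := boolP [disjoint nb g (lev g X 3) & lev g X 4]; last first.
  move/pred0Pn => [v /andP[/= /forced_nb[S cS fS] /forced[S' cS' fS']]].
  exists (S :|: S').
    by apply: leq_trans (leq_card_setU _ _) _; apply: leq_trans (leq_add cS cS') _.
  move=> A B dAB xB yA tS.
  have XB : X \subset B by rewrite sub1set.
  have vA : v \in A by apply: fS dAB XB _; apply: tightS tS; apply: subsetUl.
  have vB : v \in B by apply: fS' dAB XB _; apply: tightS tS; apply: subsetUr.
  by rewrite (disjointFr dAB vA) in vB.
have xX : x \in lev g X 4 by apply: (subsetP (lev_sub _ _ _)); rewrite inE.
case: (@barrier_absurd T c1 c2 D g g x y X (fun=> 0) (fun=> 0)) => //.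
- by rewrite sub1set !inE eqxx.
- by rewrite big1 // cards1.
- by apply: contraTN xX => xN; rewrite (disjointFr dNE xN).
Qed.

(** Now [x] and [y] both start in [B]. Once the forced sets are disjoint, either [s] and [t] are
    both forced into [A :|: B], or the flip changes at most one degree among the forced vertices,
    less than the surplus 2, and the barrier applies. *)
Lemma pair_blocker (g : rel T) x y s t : x != y -> graph g ->
  (forall v, deg g v = D v + (v == x) + (v == y)) -> s != t ->
  exists2 S : {set T}, #|S| <= 24 &
  forall A B, [disjoint A & B] -> x \in B -> y \in B ->
    (s \notin A :|: B) || (t \notin A :|: B) -> ~ tight (flip g s t) S A B.
Proof.
move=> xy gg dg st; pose X := [set x; y]; set e := flip g s t.
have [gs gi] := gg; have ge : graph e by apply: flip_graph.
have reached v : v \in nb e (lev e X 3) :|: lev e X 4 ->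
    exists2 S : {set T}, #|S| <= 12 &
    forall A B, [disjoint A & B] -> X \subset B -> tight e S A B -> v \in A :|: B.
  rewrite in_setU => /orP[/forced_nb|/forced] [S cS fS]; exists S.
  - exact: leq_trans cS _.
  - by move=> A B dAB XB tS; rewrite inE (fS _ _ dAB XB tS).
  - exact: leq_trans cS _.
  - by move=> A B dAB XB tS; rewrite inE (fS _ _ dAB XB tS) orbT.
have cU (S S' : {set T}) : #|S| <= 12 -> #|S'| <= 12 -> #|S :|: S'| <= 24.
  by move=> cS cS'; apply: leq_trans (leq_card_setU _ _) (leq_add cS cS').
have subXB (B : {set T}) : x \in B -> y \in B -> X \subset B.
  by move=> xB yB; apply/subsetP => v; rewrite !inE => /orP[]/eqP ->.
have [dNE|] := boolP [disjoint nb e (lev e X 3) & lev e X 4]; last first.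
  move/pred0Pn => [v /andP[/= /forced_nb[S cS fS] /forced[S' cS' fS']]].
  exists (S :|: S'); first by apply: cU => //; apply: leq_trans cS _.
  move=> A B dAB xB yB _ tS.
  have XB := subXB _ xB yB.
  have vA : v \in A by apply: fS dAB XB _; apply: tightS tS; apply: subsetUl.
  have vB : v \in B by apply: fS' dAB XB _; apply: tightS tS; apply: subsetUr.
  by rewrite (disjointFr dAB vA) in vB.
set R := nb e (lev e X 3) :|: lev e X 4 in reached *.
have [/andP[/reached[S cS fS] /reached[S' cS' fS']]|nst] :=
    boolP ((s \in R) && (t \in R)).
  exists (S :|: S'); first exact: cU.
  move=> A B dAB xB yB + tS; have XB := subXB _ xB yB.
  rewrite (fS A B) ?(fS' A B) //; apply: tightS tS.
    exact: subsetUr.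
  exact: subsetUl.
have inE4 v : v \in X -> v \notin nb e (lev e X 3).
  move=> vX; have : v \in lev e X 4 by apply: (subsetP (lev_sub _ _ _)).
  by apply: contraTN => vN; rewrite (disjointFr dNE vN).
have sumR : \sum_(v in R) ((v == s) + (v == t)) < #|X|.
  rewrite big_split /= !sum_eq_indicator cards2 xy.
  by move: nst; case: (s \in R) (t \in R) => [] [].
pose one v := (v == s) + (v == t).
have [est|est] := boolP (g s t).
  case: (@barrier_absurd T c1 c2 D g e x y X one (fun=> 0)) => //.
  - by move=> v; rewrite /one -(deg_del v gi gs st est) -/e addn0 addnA.
  - by apply: leq_trans sumR; rewrite ltnS; apply: leq_sum => v _; rewrite addn0.
  - by apply: inE4; rewrite !inE eqxx.
  - by apply: inE4; rewrite !inE eqxx orbT.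
case: (@barrier_absurd T c1 c2 D g e x y X (fun=> 0) one) => //.
- by move=> v; rewrite /one addn0 /e deg_add // addnA.
- by apply: inE4; rewrite !inE eqxx.
- by apply: inE4; rewrite !inE eqxx orbT.
Qed.

(** Kept on all of [T], with the vertices outside [U] isolated, so that the cut identity and the
    Erdos-Gallai theorem apply without a subtype. *)
Definition induced (g : rel T) U : rel T :=
  fun a b => [&& a \in U, b \in U & g a b].

Lemma induced_graph (g : rel T) U : graph g -> graph (induced g U).
Proof.
by move=> [gs gi]; split=> [a b|a]; rewrite /induced ?gi ?andbF // gs andbCA.
Qed.

Lemma tight_induced (g : rel T) U A B :
  (forall a w, ~~ defect (induced g U) A B a w) -> tight g U A B.
Proof.
move=> h a w aU wU; have := h a w.
by rewrite /defect /induced aU wU.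
Qed.

(* The set U1 consists of x, y, a neighbour of each, and two blockers of size at
   most 24; one more such blocker is added for each ordered pair in U1. *)
Definition repair_bound := 52 + 52 * 52 * 24.

Section Blockers.
Variables (g : rel T) (x y : T).
Hypothesis xy : x != y.
Hypothesis gg : graph g.
Hypothesis dg : forall v, deg g v = D v + (v == x) + (v == y).

(** Lowering [x] and [y] by one costs at most 2 of the slack, so a violated cut has at most one
    defect inside [U]. If [U1] contains no defect, a single blocker is contradicted. Otherwise [x]
    and [y] lie in [B], and flipping the defective pair contradicts its pair blocker. *)
Lemma cut_from_blockers (U1 U : {set T}) d :
  U1 \subset U ->
  (forall A B, [disjoint A & B] -> x \in B -> y \notin A -> ~ tight g U1 A B) ->
  (forall A B, [disjoint A & B] -> y \in B -> x \notin A -> ~ tight g U1 A B) ->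
  (forall s t, s \in U1 -> t \in U1 -> s != t ->
   forall A B, [disjoint A & B] -> x \in B -> y \in B ->
     (s \notin A :|: B) || (t \notin A :|: B) -> ~ tight (flip g s t) U A B) ->
  (forall v, deg (induced g U) v = d v + (v == x) + (v == y)) ->
  cut_condition d.
Proof.
move=> U1U bx bY bp dd A B dAB.
set e := induced g U in dd; have ge : graph e by apply: induced_graph.
have [gs gi] := gg.
have sd (C : {set T}) : \sum_(v in C) deg e v = \sum_(v in C) d v + (x \in C) + (y \in C).
  rewrite -!sum_eq_indicator -!big_split; apply: eq_bigr => v _; exact: dd.
have := cut_identity ge dAB; rewrite -addnA -card_defects // !sd.
set Def := [set p | _].
rewrite leqNgt => id; apply/negP => viol.
have lt : #|Def| + (x \in A) + (y \in A) < (x \in B) + (y \in B) by nlia.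
have xAB := disjointFr dAB (x := x); have yAB := disjointFr dAB (x := y).
have def_gt0 : 0 < #|Def|.
  rewrite lt0n; apply/negP; rewrite cards_eq0 => /eqP D0.
  have tU : tight g U A B.
    apply: tight_induced => a w; have : (a, w) \notin Def by rewrite D0 inE.
    by rewrite inE.
  have tU1 := tightS U1U tU.
  move: lt; rewrite D0 cards0; case: (boolP (x \in B)) => xB; last first.
    case: (boolP (y \in B)) => yB; last by [].
    by case: (boolP (x \in A)) => xA; [nlia | case: (bY A B)].
  case: (boolP (y \in A)) => yA; last by case: (bx A B).
  by rewrite (yAB yA); nlia.
have [xB yB D1] : [/\ x \in B, y \in B & #|Def| <= 1].
  by move: lt def_gt0; case: (x \in B) (y \in B) => [] [] lt def_gt0; split=> //; nlia.
have yA : y \notin A by rewrite (disjointFl dAB yB).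
have uniq p q : p \in Def -> q \in Def -> p = q.
  by move=> pD qD; apply: (card_le1_eqP D1).
have inDef a w : a \in U -> w \in U -> ((a, w) \in Def) = defect g A B a w.
  by move=> aU wU; rewrite inE /= /defect /e /induced aU wU.
have [[s t] /and3P[/= sU1 tU1 st]|none] :=
  pickP [pred p | [&& p.1 \in U1, p.2 \in U1 & defect g A B p.1 p.2]]; last first.
  case: (bx A B) => // a w aU wU; have := none (a, w).
  by rewrite /= aU wU /= => ->.
have sU := subsetP U1U _ sU1; have tU := subsetP U1U _ tU1.
have neq : s != t.
  by apply: contraTneq st => ->; rewrite /defect eqxx gi !andbF.
(* A defect with both ends in [A] or both in [B] would occur in both orders; as only one defect
   exists, [t] lies outside both sets. *)
have nts : ~~ defect g A B t s.
  apply: contraNN neq => ts.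
  by have [->] : (s, t) = (t, s) by apply: uniq; rewrite inDef.
have tAB : t \notin A :|: B.
  rewrite inE negb_or; move: st nts; rewrite /defect [t == s]eq_sym neq [g t s]gs.
  case: (boolP (s \in A)) => sA.
    rewrite (disjointFr dAB sA) /= orbF => /andP[-> ->].
    by case: (t \in A).
  by case: (s \in B) => //= /andP[/negbTE -> ->]; rewrite /= andbT.
case: (bp s t sU1 tU1 neq A B) => //; first by rewrite tAB orbT.
have [tA tB] : t \notin A /\ t \notin B by move: tAB; rewrite inE negb_or => /andP.
(* Flipping [s] and [t] removes the only defect and creates none. *)
move=> a w aU wU.
have [/andP[/eqP -> /eqP ->]|aw] := boolP ((a == s) && (w == t)).
  move: st; rewrite /defect /flip !eqxx /=.
  case: (boolP (s \in A)) => sA; last by case: (s \in B) => //= /andP[_ ->]; rewrite andbF.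
  by rewrite (disjointFr dAB sA) /= orbF => /and3P[_ _ /negbTE ->]; rewrite /= !andbF.
have [/andP[/eqP -> /eqP ->]|aw'] := boolP ((a == t) && (w == s)).
  by rewrite /defect (negbTE tA) (negbTE tB).
have -> : defect (flip g s t) A B a w = defect g A B a w.
  by rewrite /defect /flip (negbTE aw) (negbTE aw') addbF.
apply: contraNN aw => daw.
have [-> ->] : (a, w) = (s, t) by apply: uniq; rewrite inDef.
by rewrite !eqxx.
Qed.

(** The degrees inside [U], lowered by one at [x] and at [y], satisfy the Erdos-Gallai condition
    thanks to the blockers; a realization of them replaces the graph induced on [U]. *)
Lemma local_repair : exists2 U : {set T}, #|U| <= repair_bound &
  exists2 h, graph h & deg h =1 D /\
    forall a b, ~~ ((a \in U) && (b \in U)) -> h a b = g a b.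
Proof.
have [gs gi] := gg.
have dg' v : deg g v = D v + (v == y) + (v == x) by rewrite dg addnAC.
have yx : y != x by rewrite eq_sym.
have [Sx cSx bSx] := single_blocker xy gg dg.
have [Sy cSy bSy] := single_blocker yx gg dg'.
have nbr v : 0 < deg g v -> exists w, g v w.
  move=> dv; apply/existsP; apply: contraTT dv; rewrite negb_exists => /forallP h.
  by rewrite -eqn0Ngt /deg big1 // => w _; apply/eqP; rewrite eqb0.
have [x' xx'] : exists w, g x w by apply: nbr; rewrite dg eqxx; nlia.
have [y' yy'] : exists w, g y w by apply: nbr; rewrite dg eqxx; nlia.
(* The neighbours [x'] and [y'] keep the degrees of [x] and [y] inside [U] positive, so that the
   truncated subtraction in [d] is exact. *)
pose U1 := [set x; x'] :|: [set y; y'] :|: (Sx :|: Sy).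
have cU1 : #|U1| <= 52.
  apply: leq_trans (leq_card_setU _ _) _; apply: (@leq_add _ _ 4 48).
    by apply: leq_trans (leq_card_setU _ _) _; rewrite !cards2; do 2!case: eqP.
  exact: leq_trans (leq_card_setU _ _) (leq_add cSx cSy).
have /fin_all_exists[F FP] (p : T * T) : exists S : {set T}, #|S| <= 24 /\
    (p.1 != p.2 -> forall A B, [disjoint A & B] -> x \in B -> y \in B ->
     (p.1 \notin A :|: B) || (p.2 \notin A :|: B) -> ~ tight (flip g p.1 p.2) S A B).
  have [st|st] := eqVneq p.1 p.2; first by exists set0; rewrite cards0.
  by have [S cS bS] := pair_blocker xy gg dg st; exists S.
pose U := U1 :|: \bigcup_(p in setX U1 U1) F p.
have U1U : U1 \subset U by apply: subsetUl.
have inU v : v \in [set x; x'] :|: [set y; y'] -> v \in U.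
  by move=> vin; rewrite 2!in_setU vin.
have [xU x'U yU y'U] : [/\ x \in U, x' \in U, y \in U & y' \in U].
  by split; apply: inU; rewrite !inE eqxx ?orbT.
exists U.
  apply: leq_trans (leq_card_setU _ _) _; apply: leq_add => //.
  apply: leq_trans (card_bigcup _ (fun p => (FP p).1)) _.
  by rewrite leq_mul2r cardsX leq_mul ?orbT.
set e := induced g U; have ge : graph e by apply: induced_graph.
have pos v w : v \in U -> w \in U -> g v w -> 0 < deg e v.
  by move=> vU wU vw; rewrite /deg (bigD1 w) //= /e /induced vU wU vw.
pose d v := deg e v - (v == x) - (v == y).
have dd v : deg e v = d v + (v == x) + (v == y).
  rewrite /d; have [->|_] := eqVneq v x.
    by rewrite (negbTE xy); have := pos x x' xU x'U xx'; nlia.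
  have [->|_] := eqVneq v y; last by nlia.
  by have := pos y y' yU y'U yy'; nlia.
have even_d : ~~ odd (\sum_v d v).
  have := handshake ge; rewrite (eq_bigr _ (fun v _ => dd v)) !big_split /=.
  have sum1 (u : T) : \sum_v (v == u : nat) = 1.
    by rewrite (bigD1 u) //= eqxx big1 // => v /negbTE ->.
  by rewrite !sum1 !oddD /= addbT addbT negbK.
have cut : cut_condition d.
  apply: (@cut_from_blockers U1 U d) => //.
  - move=> A B dAB xB yA tS; apply: (bSx A B) => //; apply: tightS tS.
    by apply/subsetP => v vS; rewrite !inE vS !orbT.
  - move=> A B dAB xB yA tS; apply: (bSy A B) => //; apply: tightS tS.
    by apply/subsetP => v vS; rewrite !inE vS !orbT.
  - move=> s t sU tU st A B dAB xB yB nst tS; have [_ bp] := FP (s, t).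
    apply: (bp st A B) => //; apply: tightS tS.
    apply: subset_trans (subsetUr _ _); apply: (bigcup_sup (s, t)) => //.
    by rewrite inE sU tU.
have [k [ks ki] dk] := erdos_gallai even_d cut.
(* The targets vanish outside [U], hence [k] has no edge with an end there and can be glued to the
   rest of [g]. *)
have kU v w : v \notin U -> k v w = false.
  move=> vU; have : d v = 0.
    suff : deg e v = 0 by rewrite dd; nlia.
    by apply: big1 => u _; rewrite /e /induced (negbTE vU).
  rewrite -dk /deg (bigD1 w) //=; by case: (k v w).
pose h : rel T := fun a b => if (a \in U) && (b \in U) then k a b else g a b.
exists h.
  by split=> [a b|a]; rewrite /h ?ki ?gi ?if_same // [(b \in U) && _]andbC ks gs.
split; last by move=> a b /negbTE; rewrite /h => ->.
move=> v; have [vU|vU] := boolP (v \in U); last first.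
  have -> : deg h v = deg g v by apply: eq_bigr => w _; rewrite /h (negbTE vU).
  rewrite dg; have -> : (v == x) = false by apply: contraNF vU => /eqP ->.
  by have -> : (v == y) = false by [apply: contraNF vU => /eqP ->]; rewrite !addn0.
have hU : degin h U v = d v.
  rewrite -dk (@deg_anti _ k U) => [|w wU]; last by rewrite ks kU.
  by apply: eq_bigr => w wU; rewrite /h vU wU.
have hC : degin h (~: U) v = degin g (~: U) v.
  by apply: eq_bigr => w; rewrite inE /h => /negbTE ->; rewrite andbF.
have eU : deg e v = degin g U v.
  rewrite (@deg_anti _ e U) => [|w wU]; last by rewrite /e /induced (negbTE wU) andbF.
  by apply: eq_bigr => w wU; rewrite /e /induced vU wU.
rewrite (deg_split h U) hU hC; have := dg v; rewrite (deg_split g U) -eU dd.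
nlia.
Qed.

End Blockers.
End Repair.

(** * Adjacency matrices and sequences as relations and functions *)

Lemma realizationsP n (G : 'M[bool]_n) (d : 'I_n -> nat) :
  reflect (graph (fun i j => G i j) /\ deg (fun i j => G i j) =1 d)
          (G \in realizations d).
Proof.
have degE i : degree G i = deg (fun i j => G i j) i.
  rewrite /degree /deg -sum1dep_card big_mkcond.
  by apply: eq_bigr => j _; case: (G i j).
rewrite inE; apply: (iffP andP) => [[/andP[/forallP Gi /forallP Gs] /forallP Gd]|].
  split; last by move=> i; rewrite -degE; apply/eqP.
  by split=> [i j|i]; [apply/eqP; have /forallP := Gs i; apply | apply/negbTE].
move=> [[Gs Gi] Gd]; split.
  apply/andP; split; apply/forallP => i; first by rewrite Gi.
  by apply/forallP => j; rewrite Gs.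
by apply/forallP => i; rewrite degE Gd.
Qed.

Lemma realizations_rel n (d : 'I_n -> nat) (g : rel 'I_n) :
  graph g -> deg g =1 d -> (\matrix_(i, j) g i j)%R \in realizations d.
Proof.
move=> [gs gi] gd; apply/realizationsP.
have E : (fun i j => (\matrix_(i, j) g i j)%R i j) = g.
  by apply/funext => i; apply/funext => j; rewrite mxE.
by rewrite E.
Qed.

Lemma graphic_rel (D : seq nat) n (f : 'I_n -> nat) : size D = n ->
  (forall i : 'I_n, nth 0 D i = f i) -> graphic D ->
  exists2 g : rel 'I_n, graph g & deg g =1 f.
Proof.
move=> sD; case: n / sD f => f fD [G /realizationsP[gG dG]].
by exists (fun i j => G i j) => // i; rewrite dG -fD.
Qed.

Lemma DD_codom n Sigma c1 c2 (f : 'I_n -> nat) : c1 < n -> 0 < c2 ->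
  ~~ odd Sigma -> (forall i, c2 <= f i <= c1) -> \sum_i f i = Sigma ->
  DD n Sigma c1 c2 (codom f).
Proof.
move=> c1n c20 oS fc sf.
have ss : sumn (codom f) = Sigma by rewrite sumnE big_image /= sf.
have sz : size (codom f) = n by rewrite size_codom card_ord.
split=> //; last by apply/allP => _ /codomP[i ->].
rewrite /degree_sequence ss oS sz andbT; apply/allP => _ /codomP[i ->].
by have := fc i; lia.
Qed.

Lemma fully_graphic_rel n Sigma c1 c2 : c1 < n -> 0 < c2 -> ~~ odd Sigma ->
  fully_graphic (DD n Sigma c1 c2) ->
  forall f : 'I_n -> nat, (forall i, c2 <= f i <= c1) -> \sum_i f i = Sigma ->
  exists2 g : rel 'I_n, graph g & deg g =1 f.
Proof.
move=> c1n c20 oS full f fc sf.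
apply: (graphic_rel _ _ (full _ (DD_codom c1n c20 oS fc sf))).
  by rewrite size_codom card_ord.
by move=> i; rewrite codomE (nth_map i) ?size_enum_ord ?nth_ord_enum.
Qed.

(** * Counting realizations up to a bounded repair *)

Section Counting.
Variables (n K : nat) (d d' : 'I_n -> nat) (x : 'I_n).
Hypothesis repair : forall G, G \in realizations d' ->
  exists2 U : {set 'I_n}, #|U| <= K &
  exists2 H, H \in realizations d &
    forall i j, ~~ ((i \in U) && (j \in U)) -> H i j = G i j.

(** The decoding map: the tuple lists the repaired vertices, possibly with repetitions, and [m]
    holds the original adjacencies among its entries. *)
Definition overwrite (p : 'M[bool]_n * K.-tuple 'I_n * 'M[bool]_K) : 'M[bool]_n :=
  let: (H, t, m) := p in
  (\matrix_(i, j) if (i \in t) && (j \in t)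
                  then [exists a, exists b, [&& tnth t a == i, tnth t b == j & m a b]]
                  else H i j)%R.

Lemma card_realizations_le :
  #|realizations d'| <= #|realizations d| * (n ^ K * 2 ^ (K * K)).
Proof.
pose codes := setX (setX (realizations d) [set: K.-tuple 'I_n]) [set: 'M[bool]_K].
have cc : #|codes| = #|realizations d| * (n ^ K * 2 ^ (K * K)).
  by rewrite !cardsX !cardsT card_tuple card_ord card_mx card_bool mulnA.
rewrite -cc; apply: leq_trans (leq_imset_card overwrite _).
apply: subset_leq_card; apply/subsetP => G /repair[U cU [H HR HG]].
(* The list of [U] is padded with [x] to length [K]. That [x] may lie outside [U] is harmless,
   because [m] records [G] on all listed vertices. *)
have st : size (enum U ++ nseq (K - #|U|) x) == K.
  by rewrite size_cat size_nseq -cardE subnKC.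
pose t := Tuple st; pose m := (\matrix_(a, b) G (tnth t a) (tnth t b))%R : 'M[bool]_K.
apply/imsetP; exists (H, t, m); first by rewrite !in_setX HR !in_setT.
have Ut i : i \in U -> i \in t by move=> iU; rewrite mem_cat mem_enum iU.
apply/matrixP => i j; rewrite mxE; case: ifPn => [/andP[/tnthP[a ->] /tnthP[b ->]]|nt].
  apply/idP/existsP => [Gab|[a' /existsP[b' /and3P[/eqP <- /eqP <-]]]].
    by exists a; apply/existsP; exists b; rewrite !eqxx mxE.
  by rewrite mxE.
by rewrite HG //; apply: contraNN nt => /andP[/Ut -> /Ut ->].
Qed.

End Counting.

(** Both constants come from the repair bound alone: [size D ^ K] counts the tuples and [C] the
    boolean matrices of size [K]. *)
Lemma add_units_bound : exists C K, forall n Sigma c1 c2 (D : seq nat),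
  c1 < n -> 0 < c2 -> ~~ odd Sigma -> fully_graphic (DD n Sigma c1 c2) ->
  DD n Sigma c1 c2 D -> forall i j : 'I_(size D), i != j ->
  #|realizations (add_units (@entry D) i j)|
    <= #|realizations (@entry D)| * (size D ^ K * C).
Proof.
exists (2 ^ (repair_bound * repair_bound)), repair_bound.
move=> n Sigma c1 c2 D c1n c20 oS full [_ sD allD sumD] i j ij.
subst n; apply: (card_realizations_le i) => G /realizationsP[gG dG].
have Dc v : c2 <= @entry D v <= c1.
  by apply: (allP allD (@entry D _)); apply: mem_nth.
have sumE : \sum_v @entry D v = Sigma.
  by rewrite -sumD sumnE (big_nth 0) big_mkord.
have all_graphic (f : 'I_(size D) -> nat) : (forall v, c2 <= f v <= c1) ->
    \sum_v f v = \sum_v @entry D v -> exists2 g, graph g & deg g =1 f.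
  by rewrite sumE => fc; apply: (fully_graphic_rel c1n c20 oS full fc).
have [U cU [h gh [dh hG]]] := local_repair c20 Dc all_graphic ij gG dG.
exists U => //; exists (\matrix_(a, b) h a b)%R; first exact: realizations_rel.
by move=> a b ab; rewrite mxE hG.
Qed.

(** * Infinitely many fully graphic regions *)

Lemma ones_graphic n : ~~ odd n ->
  exists2 g : rel 'I_n, graph g & deg g =1 (fun=> 1).
Proof.
move=> on; apply: erdos_gallai => [|A B dAB]; rewrite !sum1_card ?card_ord //.
have [->|[a aA]] := set_0Vmem A; first by rewrite cards0.
have AB : #|A| <= #|~: B|.
  by apply: subset_leq_card; rewrite -disjoints_subset.
have A0 : 0 < #|A| by apply/card_gt0P; exists a.
have := cardsC B; rewrite card_ord => cB.
have [big|small] := leqP 2 #|~: B|.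
  by apply: leq_trans (leq_addr _ _); rewrite addnn -muln2 leq_mul2l big orbT.
have eB : #|~: B| = 1 by lia.
have eA : #|A| = 1 by lia.
have n2 : 1 < n.
  by rewrite ltnNge; apply: contraNN on => n1; rewrite (_ : n = 1) //; lia.
by rewrite eA eB; lia.
Qed.

(** With both bounds equal to 1 the region contains only the sequence of ones, realized by a perfect
    matching. *)
Lemma ones_region n : 1 < n -> ~~ odd n ->
  fully_graphic (DD n n 1 1) /\ DD n n 1 1 (nseq n 1).
Proof.
move=> n1 on; split=> [D [_ sD allD _]|].
  have [g gg dg] : exists2 g : rel 'I_(size D), graph g & deg g =1 (fun=> 1).
    by apply: ones_graphic; rewrite sD.
  exists (\matrix_(i, j) g i j)%R; apply: realizations_rel => // i.
  rewrite dg; apply/eqP; rewrite eq_sym eqn_leq andbC.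
  by apply: (allP allD (@entry D _)); apply: mem_nth.
split; rewrite ?size_nseq //.
- rewrite /degree_sequence size_nseq sumn_nseq mul1n on andbT.
  by apply/allP => d /nseqP[-> _]; rewrite /= subn_gt0.
- by apply/allP => d /nseqP[-> _].
- by rewrite sumn_nseq mul1n.
Qed.

(** * P-stability of the union *)

Import Order.Theory GRing.Theory Num.Theory.

Local Open Scope classical_set_scope.

Theorem corollary1p4 :
  P_stable [set D : seq nat | exists n Sigma c1 c2 : nat,
    [/\ [/\ c1 < n, c2 <= c1 & 0 < c2]%N,
        (0 < Sigma)%N /\ ~~ odd Sigma,
        fully_graphic (DD n Sigma c1 c2) &
        DD n Sigma c1 c2 D]].
Proof.
split.
- by move=> D [n [Sigma [c1 [c2 [_ _ _ []]]]]].
(* The lengths are even, and at least 2 so that the upper bound 1 stays below the length. *)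
- pose f k := nseq k.*2.+2 1.
  have f_inj : injective f.
    by move=> k l /(congr1 size); rewrite !size_nseq => -[/double_inj].
  move=> finA; apply: infinite_nat.
  have := finite_preimage (in2W f_inj) finA; apply: sub_finite_set => k _ /=.
  have on : ~~ odd k.*2.+2 by rewrite /= negbK odd_double.
  have [full mem] := ones_region (isT : 1 < k.*2.+2) on.
  by exists k.*2.+2, k.*2.+2, 1, 1.
have [C [K bound]] := add_units_bound.
(* Each quotient is at most [C] times the [K]-th power of the length, and the sum is enlarged to all
   ordered pairs, whence the exponent [K + 2]. *)
exists (C%:R *: 'X^(K + 2))%R => D [n [Sigma [c1 [c2 [[c1n _ c20] [_ oS] full memD]]]]].
move=> [G GR].
have R0 : (0 < #|realizations (@entry D)|%:R :> rat)%R.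
  by rewrite ltr0n; apply/card_gt0P; exists G.
rewrite hornerZ hornerXn /partial_pp.
have term (i j : 'I_(size D)) : (i < j)%N ->
  (#|realizations (add_units (@entry D) i j)|%:R / #|realizations (@entry D)|%:R
   <= (size D ^ K * C)%:R :> rat)%R.
  move=> ij; rewrite ler_pdivrMr // -natrM ler_nat mulnC.
  by apply: bound full memD _ _ _ => //; rewrite neq_ltn ij.
apply: (@le_trans _ _ (\sum_(i < size D) \sum_(j < size D) (size D ^ K * C)%:R)%R).
  apply: ler_sum => i _; rewrite big_mkcond; apply: ler_sum => j _.
  by case: ifP => [/term//|_]; apply: ler0n.
rewrite !sumr_const !card_ord -!natrX -natrM -!mulrnA ler_nat addn2 !expnS.
by rewrite leq_eqVlt; apply/orP; left; apply/eqP; lia.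
Qed.
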